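(* Let $W,Y_1,\dots,Y_n\in\mathrm{Ray}(V)$ be given and $C:=\mathrm{conv}(Y_1,\dots,Y_n)$. Then the $eR$-valued function $\mathrm{CS}(W,-)$ on $C$ has a minimum. It is attained at $Y_r$ for some $r\in\{1,\dots,n\}$ or at the $W$-median $M_W(Y_r,Y_s)$ of some interval $[Y_r,Y_s]$, $1\le r\le s\le n$, on which $\mathrm{CS}(W,-)$ is not monotone.
   Context: A supertropical semiring is a commutative semiring $R$ such that $e:=1+1$ satisfies $e+e=e$ and, for all $a,b\in R$: $a+b\in\{a,b\}$ if $ea\ne eb$, and $a+b=ea$ if $ea=eb$. Then $eR$ is a bipotent semiring with unit $e$, totally ordered by $a\le b\Leftrightarrow a+b=b$. Assume $eR$ is a semifield. $V$ is an $R$-module with a quadratic pair $(q,b)$: $q:V\to R$ with $q(ax)=a^2q(x)$, and $b:V\times V\to R$ symmetric bilinear with $q(x+y)=q(x)+q(y)+b(x,y)$. Assume $q$ is anisotropic: $q^{-1}(0)=\{0\}$. Rays: $x\sim x'$ in $V\setminus\{0\}$ iff $\lambda x=\mu x'$ for some $\lambda,\mu\in R\setminus\{0\}$; the classes are the rays, $\mathrm{ray}(x)$ is the class of $x$, and $\mathrm{Ray}(V)$ is the set of rays. For $X=\mathrm{ray}(x)$, $Y=\mathrm{ray}(y)$: $[X,Y]=\{\mathrm{ray}(\lambda x+\mu y)\mid\lambda,\mu\in R,\text{ not both }0\}$. A set $A\subset\mathrm{Ray}(V)$ is convex if $[X,Y]\subset A$ for all $X,Y\in A$; $\mathrm{conv}(\cdot)$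 denotes the convex hull (smallest convex set containing the given rays). The CS-ratio is $\mathrm{CS}(X,Y):=\dfrac{e\,b(x,y)^2}{e\,q(x)q(y)}\in eR$ (independent of the choice of $x\in X$, $y\in Y$). The interval $[X,Y]$ is totally ordered by $Z_1\le_X Z_2\Leftrightarrow[X,Z_1]\subset[X,Z_2]$; $\mathrm{CS}(W,-)$ is monotone on $[X,Y]$ if it is (weakly) increasing or (weakly) decreasing with respect to $\le_X$. For $W=\mathrm{ray}(w)$, $X=\mathrm{ray}(x)$, $Y=\mathrm{ray}(y)$ with $b(w,x),b(w,y)$ not both zero, the $W$-median is $M_W(X,Y):=\mathrm{ray}(b(w,y)x+b(w,x)y)$. *)

(* Defs.v *)
From mathcomp Require Import all_boot all_order all_algebra.
From mathcomp Require Import boolp classical_sets.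
From mathcomp Require Import ring.

Set Implicit Arguments.
Unset Strict Implicit.
Unset Printing Implicit Defensive.

Import GRing.Theory.
Local Open Scope classical_set_scope.
Local Open Scope ring_scope.

(* The element e. *)
Definition ghost_one (R : comPzSemiRingType) : R := 1 + 1.

(* The ideal eR, as a subset of R. *)
Definition ghost (R : comPzSemiRingType) : set R :=
  range (fun a : R => ghost_one R * a).

Definition supertropical (R : comPzSemiRingType) : Prop :=
  let e := ghost_one R in
  e + e = e /\
  forall a b : R,
    (e * a <> e * b -> a + b = a \/ a + b = b) /\
    (e * a = e * b -> a + b = e * a).

(* eR is a semiring with unit element e; the condition e <> 0 only excludes
   the zero semiring. *)
Definition ghost_semifield (R : comPzSemiRingType) : Prop :=
  let e := ghost_one R in
  e <> 0 /\
  forall a : R, ghost a -> a <> 0 -> exists2 c : R, ghost c & a * c = e.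

(* The ordering of eR; it is only used for elements of eR. *)
Definition ghost_le (R : comPzSemiRingType) (a b : R) : Prop := a + b = b.

(* Inverse in the semifield eR, with value 0 if there is none. *)
Definition ghost_inv (R : comPzSemiRingType) (a : R) : R :=
  xget 0 [set c : R | ghost c /\ a * c = ghost_one R].

(* Linearity of b in its second argument follows by symmetry. *)
Definition quadratic_pair (R : comPzSemiRingType) (V : lSemiModType R)
    (q : V -> R) (b : V -> V -> R) : Prop :=
  [/\ forall (a : R) (x : V), q (a *: x) = a ^+ 2 * q x,
      forall x y : V, b x y = b y x,
      forall x y z : V, b (x + y) z = b x z + b y z,
      forall (a : R) (x y : V), b (a *: x) y = a * b x y &
      forall x y : V, q (x + y) = q x + q y + b x y].

Definition anisotropic (R : comPzSemiRingType) (V : lSemiModType R)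
    (q : V -> R) : Prop :=
  q @^-1` [set 0] = [set 0].

(* The class of x in V \ {0}; meaningful only for x <> 0. *)
Definition ray (R : comPzSemiRingType) (V : lSemiModType R) (x : V) : set V :=
  [set x' : V | x' <> 0 /\
    exists l m : R, [/\ l <> 0, m <> 0 & l *: x = m *: x']].

Definition Ray (R : comPzSemiRingType) (V : lSemiModType R) : set (set V) :=
  [set X : set V | exists2 x : V, x <> 0 & X = ray x].
Arguments Ray {R} V.

(* A chosen representative of a ray.  The notions defined below through [rep]
   do not depend on this choice: see [interval_ray], [CS_ray], [median_ray],
   [has_median_ray]. *)
Definition rep (R : comPzSemiRingType) (V : lSemiModType R) (X : set V) : V :=
  xget 0 X.

(* [X, Y] *)
Definition interval (R : comPzSemiRingType) (V : lSemiModType R)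
    (X Y : set V) : set (set V) :=
  [set Z : set V | exists l m : R,
    ~ (l = 0 /\ m = 0) /\ Z = ray (l *: rep X + m *: rep Y)].

Definition convex (R : comPzSemiRingType) (V : lSemiModType R)
    (A : set (set V)) : Prop :=
  A `<=` Ray V /\ forall X Y : set V, A X -> A Y -> interval X Y `<=` A.

Definition conv (R : comPzSemiRingType) (V : lSemiModType R)
    (S : set (set V)) : set (set V) :=
  smallest (@convex R V) S.

Definition CS (R : comPzSemiRingType) (V : lSemiModType R)
    (q : V -> R) (b : V -> V -> R) (X Y : set V) : R :=
  let x := rep X in let y := rep Y in let e := ghost_one R in
  (e * b x y ^+ 2) * ghost_inv (e * (q x * q y)).

(* The relation Z1 <=_X Z2. *)
Definition interval_le (R : comPzSemiRingType) (V : lSemiModType R)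
    (X Z1 Z2 : set V) : Prop :=
  interval X Z1 `<=` interval X Z2.

Definition monotone_on_interval (R : comPzSemiRingType) (V : lSemiModType R)
    (f : set V -> R) (X Y : set V) : Prop :=
  (forall Z1 Z2 : set V, interval X Y Z1 -> interval X Y Z2 ->
     interval_le X Z1 Z2 -> ghost_le (f Z1) (f Z2)) \/
  (forall Z1 Z2 : set V, interval X Y Z1 -> interval X Y Z2 ->
     interval_le X Z1 Z2 -> ghost_le (f Z2) (f Z1)).

Definition has_median (R : comPzSemiRingType) (V : lSemiModType R)
    (b : V -> V -> R) (W X Y : set V) : Prop :=
  ~ (b (rep W) (rep X) = 0 /\ b (rep W) (rep Y) = 0).

(* M_W(X, Y); meaningful only under [has_median b W X Y]. *)
Definition median (R : comPzSemiRingType) (V : lSemiModType R)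
    (b : V -> V -> R) (W X Y : set V) : set V :=
  ray (b (rep W) (rep Y) *: rep X + b (rep W) (rep X) *: rep Y).

Section WellDefined.
Context (R : comPzSemiRingType) (V : lSemiModType R).
Context (q : V -> R) (b : V -> V -> R).
Hypotheses (stR : supertropical R) (sfR : ghost_semifield R).
Hypotheses (qb : quadratic_pair q b) (an : anisotropic q).
Local Notation e := (ghost_one R).

Lemma ghost_mul_eq0 (a : R) : e * a = 0 -> a = 0.
Proof.
move=> ea0; have [_ /(_ a 0) [_]] := stR.
by rewrite addr0 mulr0 ea0; apply.
Qed.

Lemma ghost_mul_cancel (a c d : R) : a <> 0 -> a * c = a * d -> e * c = e * d.
Proof.
move=> a0 acd; have [_ inv] := sfR.
have [|/ghost_mul_eq0//|k _ eak] := inv (e * a); first by exists a.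
have ek x : e * x = k * e * (a * x) by rewrite -{1}eak; ring.
by rewrite ek acd -ek.
Qed.

Lemma mul_nonzero (a c : R) : a <> 0 -> c <> 0 -> a * c <> 0.
Proof.
move=> a0 c0 ac0; apply: c0; apply: ghost_mul_eq0.
by rewrite (@ghost_mul_cancel a c 0) ?mulr0.
Qed.

Lemma ray_eq (x x' : V) (l m : R) :
  l <> 0 -> m <> 0 -> l *: x = m *: x' -> ray x = ray x'.
Proof.
have sub y y' (s t : R) : s <> 0 -> t <> 0 -> s *: y = t *: y' -> ray y `<=` ray y'.
  move=> s0 t0 E z [z0 [a [c [a0 c0 F]]]]; split=> //.
  exists (a * t), (s * c); split; try exact: mul_nonzero.
  by rewrite -!scalerA -E -F !scalerA mulrC.
by move=> l0 m0 E; apply/seteqP; split; [exact: sub E | apply: sub (esym E)].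
Qed.

Lemma one_nonzero : (1 : R) <> 0.
Proof. by have [e0 _] := sfR => H; apply: e0; rewrite /ghost_one H addr0. Qed.

Lemma rep_ray (x : V) : x <> 0 -> rep (ray x) <> 0 /\
  exists l m : R, [/\ l <> 0, m <> 0 & l *: x = m *: rep (ray x)].
Proof.
move=> x0; apply: (@xgetI V 0 (ray x) x); split=> //.
by exists 1, 1; split=> //; exact: one_nonzero.
Qed.

Lemma ray_rep (x : V) : x <> 0 -> ray (rep (ray x)) = ray x.
Proof. by case/rep_ray=> _ [l [m [l0 m0 /esym E]]]; exact: ray_eq E. Qed.

Lemma q_eq0 (x : V) : q x = 0 -> x = 0.
Proof. by move=> qx; have : (q @^-1` [set 0]) x by []; rewrite an. Qed.

Lemma interval_ray (x y : V) : x <> 0 -> y <> 0 ->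
  interval (ray x) (ray y) =
  [set Z | exists l m : R, ~ (l = 0 /\ m = 0) /\ Z = ray (l *: x + m *: y)].
Proof.
move=> /rep_ray[_ [a [a' [a0 a0' E]]]] /rep_ray[_ [c [c' [c0 c0' F]]]].
have key (u v u' v' : V) (s s' t t' : R) :
    s <> 0 -> s' <> 0 -> t <> 0 -> t' <> 0 ->
    s *: u = s' *: u' -> t *: v = t' *: v' ->
    [set Z | exists l m : R, ~ (l = 0 /\ m = 0) /\ Z = ray (l *: u + m *: v)]
    `<=` [set Z | exists l m : R, ~ (l = 0 /\ m = 0) /\ Z = ray (l *: u' + m *: v')].
  move=> s0 s0' t0 t0' G H Z [l [m [lm0 ->]]].
  exists (l * s' * t), (m * t' * s); split.
    case=> L M; apply: lm0; split; apply: contrapT => N.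
      by case: (mul_nonzero (mul_nonzero N s0') t0).
    by case: (mul_nonzero (mul_nonzero N t0') s0).
  apply: (@ray_eq _ _ (s * t) 1); [exact: mul_nonzero | exact: one_nonzero |].
  rewrite scale1r scalerDr !scalerA.
  have -> : s * t * l = l * t * s by ring.
  have -> : s * t * m = m * s * t by ring.
  by rewrite -!scalerA G H !scalerA; congr (_ *: _ + _ *: _); ring.
apply/seteqP; split; last exact: key a0 a0' c0 c0' E F.
exact: key a0' a0 c0' c0 (esym E) (esym F).
Qed.

Lemma bilZr (a : R) (x y : V) : b x (a *: y) = a * b x y.
Proof. by have [_ bC _ bZ _] := qb; rewrite bC bZ bC. Qed.

Lemma CS_ray (x y : V) : x <> 0 -> y <> 0 ->
  CS q b (ray x) (ray y) = e * b x y ^+ 2 * ghost_inv (e * (q x * q y)).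
Proof.
have [qZ _ _ bZ _] := qb; have [_ inv] := sfR.
have invP (z t : V) : z <> 0 -> t <> 0 ->
    ghost (ghost_inv (e * (q z * q t))) /\
    e * (q z * q t) * ghost_inv (e * (q z * q t)) = e.
  move=> z0 t0; have [||c gc ec] := inv (e * (q z * q t)); first by exists (q z * q t).
    by move=> /ghost_mul_eq0; apply: mul_nonzero => /q_eq0.
  by apply: (@xgetI _ 0 [set k | ghost k /\ _ * k = _] c).
have e_idem : e = e * e by have [ee _] := stR; rewrite {3}/ghost_one mulrDr mulr1 ee.
have ee (a : R) : ghost a -> e * a = a.
  by case=> k _ <-; rewrite mulrA -e_idem.
move=> x0 y0.
have [X0 [l [l' [l0 l0' E]]]] := rep_ray x0.
have [Y0 [m [m' [m0 m0' F]]]] := rep_ray y0.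
rewrite /CS; move: (rep (ray x)) (rep (ray y)) X0 Y0 E F => x' y' x0' y0' E F.
have [+ +] := invP _ _ x0' y0'; have [+ +] := invP _ _ x0 y0.
move: (ghost_inv (e * (q x * q y))) (ghost_inv (e * (q x' * q y'))) => f f' gf ef gf' ef'.
have Q1 : l ^+ 2 * q x = l' ^+ 2 * q x' by rewrite -!qZ E.
have Q2 : m ^+ 2 * q y = m' ^+ 2 * q y' by rewrite -!qZ F.
have B : (l * m) * b x y = (l' * m') * b x' y'.
  by rewrite -!mulrA -(bilZr m) -(bilZr m') -!bZ E F.
set P := (l * m) ^+ 2; set P' := (l' * m') ^+ 2.
have PB : P * b x y ^+ 2 = P' * b x' y' ^+ 2 by rewrite /P /P' -!exprMn B.
have PD : P * (q x * q y) = P' * (q x' * q y').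
  by rewrite /P /P' !exprMn mulrACA Q1 Q2 mulrACA.
have PP0 : P * P' <> 0.
  by rewrite /P /P' !expr2; apply: mul_nonzero; apply: mul_nonzero; apply: mul_nonzero.
have key : e * (b x y ^+ 2 * (q x' * q y')) = e * (b x' y' ^+ 2 * (q x * q y)).
  apply: (ghost_mul_cancel PP0).
  transitivity (P * b x y ^+ 2 * (P' * (q x' * q y'))); first by ring.
  by rewrite PB -PD; ring.
rewrite -[f in RHS](ee _ gf) -{2}ef' -[f' in LHS](ee _ gf') -{2}ef.
transitivity (e * (b x' y' ^+ 2 * (q x * q y)) * (e * f * f')); first by ring.
by rewrite -key; ring.
Qed.

Lemma median_ray (w x y : V) : w <> 0 -> x <> 0 -> y <> 0 ->
  median b (ray w) (ray x) (ray y) = ray (b w y *: x + b w x *: y).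
Proof.
have [_ _ _ bZ _] := qb.
move=> /rep_ray[_ [k [k' [k0 k0' D]]]].
move=> /rep_ray[_ [l [l' [l0 l0' E]]]].
move=> /rep_ray[_ [m [m' [m0 m0' F]]]].
rewrite /median; move: (rep (ray w)) (rep (ray x)) (rep (ray y)) D E F => w' x' y' D E F.
have BY : (k * m) * b w y = (k' * m') * b w' y'.
  by rewrite -!mulrA -(bilZr m) -(bilZr m') -!bZ D F.
apply: (@ray_eq _ _ (k' * l' * m') (k * l * m)).
- exact: (mul_nonzero (mul_nonzero k0' l0') m0').
- exact: (mul_nonzero (mul_nonzero k0 l0) m0).
have BX : (k * l) * b w x = (k' * l') * b w' x'.
  by rewrite -!mulrA -(bilZr l) -(bilZr l') -!bZ D E.
have -> : k' * l' * m' *: (b w' y' *: x' + b w' x' *: y') =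
    (k' * m' * b w' y') *: (l' *: x') + (k' * l' * b w' x') *: (m' *: y').
  by rewrite scalerDr !scalerA; congr (_ *: _ + _ *: _); ring.
rewrite -BY -BX -E -F scalerDr !scalerA.
by congr (_ *: _ + _ *: _); ring.
Qed.

Lemma has_median_ray (w x y : V) : w <> 0 -> x <> 0 -> y <> 0 ->
  has_median b (ray w) (ray x) (ray y) <-> ~ (b w x = 0 /\ b w y = 0).
Proof.
have [_ _ _ bZ _] := qb.
have z (u v : V) : u <> 0 -> v <> 0 ->
    b (rep (ray u)) (rep (ray v)) = 0 <-> b u v = 0.
  move=> /rep_ray[_ [k [k' [k0 k0' D]]]] /rep_ray[_ [l [l' [l0 l0' E]]]].
  move: (rep (ray u)) (rep (ray v)) D E => u' v' D E.
  have B : (k * l) * b u v = (k' * l') * b u' v'.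
    by rewrite -!mulrA -(bilZr l) -(bilZr l') -!bZ D E.
  split=> H; apply: contrapT => N.
    by case: (mul_nonzero (mul_nonzero k0 l0) N); rewrite B H mulr0.
  by case: (mul_nonzero (mul_nonzero k0' l0') N); rewrite -B H mulr0.
by move=> w0 x0 y0; rewrite /has_median !z.
Qed.

End WellDefined.

(* Main.v *)
Require Import Defs.
From mathcomp Require Import all_boot all_order all_algebra.
From mathcomp Require Import boolp classical_sets.
From mathcomp Require Import ring.

(** Write [v = \sum_i l_i y_i] for a point of the hull and [a_i = b(w, y_i)].
    In the ordering of [eR], [CS(W, ray m) <= CS(W, ray v)] means
    [b(w, m)^2 q(v) <= b(w, v)^2 q(m)].  Since sums in [eR] are maxima, this may
    be checked separately on the terms [l_r^2 q(y_r)] and [l_r l_s b(y_r, y_s)]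
    of [q(v)].  The first kind follows by comparing [m] with [y_r]; the second
    by comparing [m] with the median vector [u = a_s y_r + a_r y_s], because
    [q(u) >= a_r a_s b(y_r, y_s)] and [b(w, u) = e a_r a_s].  So the least value
    among the finitely many vertices and medians is the minimum on the hull, and
    a median strictly below both endpoints of its interval excludes
    monotonicity there. *)

Set Implicit Arguments.
Unset Strict Implicit.
Unset Printing Implicit Defensive.

Import GRing.Theory.
Local Open Scope classical_set_scope.
Local Open Scope ring_scope.
(* [interval] alone is the type of intervals of mathcomp. *)
Local Notation interval := Defs.interval.

(** * The preorder on [R] obtained by comparing ghosts [e * x] *)

Section GhostOrder.
Context (R : comPzSemiRingType).
Hypotheses (stR : supertropical R) (sfR : ghost_semifield R).
Local Notation e := (ghost_one R).
Local Notation "x <=e y" := (ghost_le (e * x) (e * y)) (at level 70).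

Lemma ghost_one_idem : e * e = e.
Proof. by have [ee _] := stR; rewrite {2}/ghost_one mulrDr mulr1 ee. Qed.

Lemma ghost_lexx x : x <=e x.
Proof. by have [ee _] := stR; rewrite /ghost_le -mulrDl ee. Qed.

Lemma ghost_le_trans y x z : x <=e y -> y <=e z -> x <=e z.
Proof. by rewrite /ghost_le => xy yz; rewrite -yz addrA xy. Qed.

(** The supertropical axiom is applied to the ghosts [e * x] and [e * y]: as [e] is idempotent, its
    case distinction concerns these elements themselves, and their sum is one of them. *)
Lemma ghost_le_total x y : x <=e y \/ y <=e x.
Proof.
have [_ /(_ (e * x) (e * y))] := stR; rewrite !mulrA ghost_one_idem => -[neq eq].
rewrite /ghost_le [e * y + _]addrC.
have [E|/neq[]] := pselect (e * x = e * y); [|by right|by left].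
by left; rewrite eq.
Qed.

Lemma ghost_le0x x : 0 <=e x.
Proof. by rewrite /ghost_le mulr0 add0r. Qed.

Lemma ghost_lex0 x : x <=e 0 -> x = 0.
Proof. by rewrite /ghost_le mulr0 addr0 => /(ghost_mul_eq0 stR). Qed.

Lemma ghost_le_addl x y : x <=e x + y.
Proof. by rewrite /ghost_le mulrDr addrA; congr (_ + _); apply: ghost_lexx. Qed.

Lemma ghost_le_addr x y : y <=e x + y.
Proof. by rewrite addrC; apply: ghost_le_addl. Qed.

Lemma ghost_le_add x y z : x <=e z -> y <=e z -> x + y <=e z.
Proof. by rewrite /ghost_le mulrDr -addrA => xz ->. Qed.

Lemma ghost_le_mul2l z x y : x <=e y -> z * x <=e z * y.
Proof.
by rewrite /ghost_le => xy; rewrite !(mulrCA e) -mulrDr xy.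
Qed.

Lemma ghost_le_mul x y x' y' : x <=e y -> x' <=e y' -> x * x' <=e y * y'.
Proof.
move=> xy x'y'; apply: (@ghost_le_trans (x * y')); first exact: ghost_le_mul2l.
by rewrite ![_ * y']mulrC; apply: ghost_le_mul2l.
Qed.

(** Nonzero factors cancel in [R] only up to [e], through inverses in [eR]; this suffices because
    the order sees only ghosts. *)
Lemma ghost_le_cancel z x y : z <> 0 -> z * x <=e z * y -> x <=e y.
Proof.
move=> z0; rewrite /ghost_le !(mulrCA e) -mulrDr.
by move=> /(ghost_mul_cancel stR sfR z0); rewrite mulrDr !mulrA ghost_one_idem.
Qed.

Lemma ghost_le_ghost x : e * x <=e x.
Proof. by rewrite /ghost_le mulrA ghost_one_idem; apply: ghost_lexx. Qed.

(** Each summand lies below the sum, and [0] is least. *)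
Lemma add_eq0 (x y : R) : x + y = 0 -> x = 0 /\ y = 0.
Proof.
move=> xy0; split; apply: ghost_lex0; rewrite -xy0.
  exact: ghost_le_addl.
exact: ghost_le_addr.
Qed.

Lemma ghost_argmin (I : finType) (i0 : I) (f : I -> R) :
  exists i, forall j, f i <=e f j.
Proof.
case: (@extremumP R I (fun x y => `[< x <=e y >]) i0 xpredT f) => //.
- by move=> x; apply/asboolP/ghost_lexx.
- by move=> y x z /asboolP xy /asboolP yz; apply/asboolP/ghost_le_trans/yz.
- by move=> x y; apply/orP; case: (ghost_le_total x y) => /asboolP; [left|right].
by move=> i _ min_i; exists i => j; apply/asboolP/min_i.
Qed.

End GhostOrder.

(** * Quadratic forms of sums and nonvanishing of vectors *)

Section QuadraticPair.
Context (R : comPzSemiRingType) (V : lSemiModType R).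
Context (q : V -> R) (b : V -> V -> R).
Hypotheses (stR : supertropical R) (sfR : ghost_semifield R).
Hypotheses (qb : quadratic_pair q b) (an : anisotropic q).
Local Notation e := (ghost_one R).
Local Notation "x <=e y" := (ghost_le (e * x) (e * y)) (at level 70).

Lemma bilDr x y z : b x (y + z) = b x y + b x z.
Proof. by have [_ bC bD _ _] := qb; rewrite ![b x _]bC bD. Qed.

Lemma quad0 : q 0 = 0.
Proof. by have [qZ _ _ _ _] := qb; rewrite -(scale0r 0) qZ expr2 !mul0r. Qed.

Lemma bil0r x : b x 0 = 0.
Proof. by rewrite -(scale0r 0) (bilZr qb) mul0r. Qed.

Lemma bil_sumr I (r : seq I) x (F : I -> V) :
  b x (\sum_(i <- r) F i) = \sum_(i <- r) b x (F i).
Proof. exact: (big_morph (b x) (bilDr x) (bil0r x)). Qed.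

(** Expanding [q] of a sum gives values [q (F i)] and [b (F i) (F j)]. The induction form avoids
    writing this double sum and suits properties closed under addition, such as upper bounds. *)
Lemma quad_sum_ind (P : R -> Prop) I (r : seq I) (F : I -> V) :
  P 0 -> (forall x y, P x -> P y -> P (x + y)) ->
  (forall i, P (q (F i))) -> (forall i j, P (b (F i) (F j))) ->
  P (q (\sum_(i <- r) F i)).
Proof.
move=> P0 PD Pq Pb; have [_ _ _ _ qD] := qb.
elim: r => [|i r IHr]; first by rewrite big_nil quad0.
rewrite big_cons qD; apply: (PD); first exact: PD.
by rewrite bil_sumr; apply: big_ind.
Qed.

Lemma quad_nonzero x : x <> 0 -> q x <> 0.
Proof. by move=> x0 /(q_eq0 an). Qed.

(** Absence of cancellation passes from [R] to [V]: all terms of [q (x + y)] vanish, and [q] is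
    anisotropic. *)
Lemma addv_eq0 (x y : V) : x + y = 0 -> x = 0 /\ y = 0.
Proof.
have [_ _ _ _ qD] := qb.
move=> /(congr1 q); rewrite qD quad0 => /(add_eq0 stR)[/(add_eq0 stR)[]].
by move=> /(q_eq0 an) -> /(q_eq0 an) ->.
Qed.

Lemma scale_eq0 (a : R) (x : V) : x <> 0 -> a *: x = 0 -> a = 0.
Proof.
have [qZ _ _ _ _] := qb.
move=> x0 /(congr1 q); rewrite qZ quad0 expr2 => ax0.
apply: contrapT => a0.
case: (@mul_nonzero R stR sfR (a * a) (q x)) => //.
  exact: (mul_nonzero stR sfR a0 a0).
exact: quad_nonzero.
Qed.

Lemma lincomb2_nonzero (l m : R) (x y : V) :
  x <> 0 -> y <> 0 -> ~ (l = 0 /\ m = 0) -> l *: x + m *: y <> 0.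
Proof.
move=> x0 y0 lm0 /addv_eq0[lx my]; apply: lm0; split.
  exact: scale_eq0 lx.
exact: scale_eq0 my.
Qed.

Lemma sumv_nonzero (I : finType) (i : I) (F : I -> V) :
  F i <> 0 -> \sum_j F j <> 0.
Proof. by rewrite (bigD1 i) //= => Fi /addv_eq0[]. Qed.

(** * Comparing CS-ratios with a fixed ray of [w] *)

Section CSOrder.
Context (w : V).
Hypothesis w0 : w <> 0.

(** The comparison of CS-ratios with denominators cleared and the common factor [q w] cancelled. *)
Definition cs_le (x y : V) : Prop := b w x ^+ 2 * q y <=e b w y ^+ 2 * q x.

(** The ratio lies in [eR] and satisfies its defining equation, so later arguments need no
    inverses. *)
Lemma CS_mul x : x <> 0 ->
  e * CS q b (ray w) (ray x) = CS q b (ray w) (ray x) /\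
  CS q b (ray w) (ray x) * (q w * q x) = e * b w x ^+ 2.
Proof.
move=> x0; have [_ inv] := sfR.
have [||c gc ec] := inv (e * (q w * q x)); first by exists (q w * q x).
  move=> /(ghost_mul_eq0 stR).
  by apply: (mul_nonzero stR sfR); apply: quad_nonzero.
have [_] : [set k : R | ghost k /\ e * (q w * q x) * k = e]
    (ghost_inv (e * (q w * q x))).
  by apply: (@xgetI _ 0 [set k | ghost k /\ _ * k = _] c).
rewrite (CS_ray stR sfR qb an w0 x0); move: (ghost_inv _) => f ef.
split; first by rewrite !mulrA (ghost_one_idem stR).
transitivity (b w x ^+ 2 * (e * (q w * q x) * f)); first by ring.
by rewrite ef mulrC.
Qed.

Lemma CS_leP x y : x <> 0 -> y <> 0 ->
  ghost_le (CS q b (ray w) (ray x)) (CS q b (ray w) (ray y)) <-> cs_le x y.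
Proof.
move=> x0 y0; rewrite /cs_le.
have [ex Ex] := CS_mul x0; have [ey Ey] := CS_mul y0; rewrite -ex -ey {ex ey}.
move: (CS _ _ _ (ray x)) (CS _ _ _ (ray y)) Ex Ey => c d Ec Ed.
have wn := quad_nonzero w0; have xn := quad_nonzero x0; have yn := quad_nonzero y0.
set K := q w * q x * q y.
have K0 : K <> 0 by do 2?apply: (mul_nonzero stR sfR).
have Kc : K * c = e * (b w x ^+ 2 * q y) by rewrite [RHS]mulrA -Ec /K; ring.
have Kd : K * d = e * (b w y ^+ 2 * q x) by rewrite [RHS]mulrA -Ed /K; ring.
have eeE u : e * (e * u) = e * u by rewrite mulrA (ghost_one_idem stR).
split.
  by move=> /(ghost_le_mul2l K); rewrite Kc Kd !eeE.
by move=> H; apply: (ghost_le_cancel stR sfR K0); rewrite Kc Kd !eeE.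
Qed.

Definition median_vec (x y : V) : V := b w y *: x + b w x *: y.

Lemma bil_median_vec x y : b w (median_vec x y) = e * (b w x * b w y).
Proof. by rewrite bilDr !(bilZr qb) /ghost_one; ring. Qed.

Lemma quad_median_vec_ge x y : b w x * b w y * b x y <=e q (median_vec x y).
Proof.
have [_ _ _ bZ qD] := qb; rewrite /median_vec qD bZ (bilZr qb).
have -> : b w x * b w y * b x y = b w y * (b w x * b x y) by ring.
exact: (ghost_le_addr stR).
Qed.

Lemma cs_le_bil0 m x : x <> 0 -> b w x = 0 -> cs_le m x -> b w m = 0.
Proof.
move=> x0; rewrite /cs_le => ->; rewrite [0 ^+ 2]expr2 !mul0r => /(ghost_lex0 stR) H.
apply: contrapT => m0.
case: (@mul_nonzero R stR sfR (b w m ^+ 2) (q x)) => //; last exact: quad_nonzero.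
by rewrite expr2; apply: (mul_nonzero stR sfR).
Qed.

(** Let u be the median vector and p = b(w,x) b(w,y). Then p b(w,m)^2 b(x,y) <= b(w,m)^2 q(u) <=
    b(w,u)^2 q(m) <= p^2 q(m), and one factor p cancels. *)
Lemma cs_le_cross m x y : x <> 0 -> y <> 0 -> cs_le m x -> cs_le m y ->
  (~ (b w x = 0 /\ b w y = 0) -> cs_le m (median_vec x y)) ->
  b w m ^+ 2 * b x y <=e b w x * b w y * q m.
Proof.
move=> x0 y0 mx my mxy.
(* If [b w m = 0], the left side vanishes. Otherwise [cs_le_bil0] makes [b w x] and [b w y] nonzero,
   so cancellation is allowed and the median hypothesis applies. *)
have [m0|m0] := pselect (b w m = 0).
  by rewrite m0 expr2 !mul0r; apply: ghost_le0x.
have bx0 : b w x <> 0 by move=> H; apply/m0/cs_le_bil0/mx.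
have by0 : b w y <> 0 by move=> H; apply/m0/cs_le_bil0/my.
apply: (ghost_le_cancel stR sfR (mul_nonzero stR sfR bx0 by0)).
have -> : b w x * b w y * (b w m ^+ 2 * b x y) =
  b w m ^+ 2 * (b w x * b w y * b x y) by ring.
apply: (@ghost_le_trans _ (b w m ^+ 2 * q (median_vec x y))).
  exact/ghost_le_mul2l/quad_median_vec_ge.
apply: (@ghost_le_trans _ (b w (median_vec x y) ^+ 2 * q m)).
  by apply: mxy => -[].
rewrite bil_median_vec exprMn [e ^+ 2]expr2 (ghost_one_idem stR) expr2 -!mulrA.
exact: (ghost_le_ghost stR).
Qed.

Lemma cs_le_sum (I : finType) (y : I -> V) (l : I -> R) m :
  (forall i, y i <> 0) -> (forall i, cs_le m (y i)) ->
  (forall i j, ~ (b w (y i) = 0 /\ b w (y j) = 0) ->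
    cs_le m (median_vec (y i) (y j))) ->
  cs_le m (\sum_i l i *: y i).
Proof.
have [qZ _ _ bZ _] := qb.
move=> y0 my mmed; rewrite /cs_le; set v := \sum_i _.
have lv i : l i * b w (y i) <=e b w v.
  rewrite /v bil_sumr (bigD1 i) //= (bilZr qb); exact: ghost_le_addl.
(* All products of two terms of [b w v] lie below its square, so each term of [q v] needs only its
   own pair of indices. *)
have lvv i j : l i * b w (y i) * (l j * b w (y j)) * q m <=e b w v ^+ 2 * q m.
  apply: ghost_le_mul (ghost_lexx stR _); rewrite expr2.
  exact: ghost_le_mul.
apply: (@quad_sum_ind (fun t => b w m ^+ 2 * t <=e b w v ^+ 2 * q m)).
- by rewrite mulr0; apply: ghost_le0x.
- by move=> s t; rewrite mulrDr; apply: ghost_le_add.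
- move=> i; rewrite qZ (mulrCA (b w m ^+ 2)); apply: (ghost_le_trans _ (lvv i i)).
  have -> : l i * b w (y i) * (l i * b w (y i)) * q m =
    l i ^+ 2 * (b w (y i) ^+ 2 * q m) by ring.
  exact/ghost_le_mul2l/my.
- move=> i j; rewrite bZ (bilZr qb); apply: (ghost_le_trans _ (lvv i j)).
  have -> : l i * b w (y i) * (l j * b w (y j)) * q m =
    l i * l j * (b w (y i) * b w (y j) * q m) by ring.
  have -> : b w m ^+ 2 * (l i * (l j * b (y i) (y j))) =
    l i * l j * (b w m ^+ 2 * b (y i) (y j)) by ring.
  exact/ghost_le_mul2l/(cs_le_cross (y0 i) (y0 j) (my i) (my j))/mmed.
Qed.

Lemma median_interval x y : x <> 0 -> y <> 0 ->
  has_median b (ray w) (ray x) (ray y) ->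
  interval (ray x) (ray y) (median b (ray w) (ray x) (ray y)).
Proof.
move=> x0 y0 /(has_median_ray stR sfR qb w0 x0 y0) bxy.
rewrite (median_ray stR sfR qb w0 x0 y0) (interval_ray stR sfR x0 y0).
by exists (b w y), (b w x); split=> // -[by0 bx0]; apply: bxy.
Qed.

Lemma medianC x y : x <> 0 -> y <> 0 ->
  median b (ray w) (ray x) (ray y) = median b (ray w) (ray y) (ray x).
Proof. by move=> x0 y0; rewrite !(median_ray stR sfR qb w0) // addrC. Qed.

End CSOrder.

(** * Endpoints of intervals and failure of monotonicity *)

Lemma interval_left (x y : V) : x <> 0 -> y <> 0 ->
  interval (ray x) (ray y) (ray x).
Proof.
move=> x0 y0; rewrite (interval_ray stR sfR x0 y0).
exists 1, 0; rewrite scale1r scale0r addr0; split=> // -[].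
by move/(one_nonzero sfR).
Qed.

Lemma interval_right (x y : V) : x <> 0 -> y <> 0 ->
  interval (ray x) (ray y) (ray y).
Proof.
move=> x0 y0; rewrite (interval_ray stR sfR x0 y0).
exists 0, 1; rewrite scale1r scale0r add0r; split=> // -[_].
by move/(one_nonzero sfR).
Qed.

Lemma interval_le_left (x z : V) : x <> 0 -> z <> 0 ->
  interval_le (ray x) (ray x) (ray z).
Proof.
move=> x0 z0; rewrite /interval_le !(interval_ray stR sfR) // => T [l [m [lm ->]]].
exists (l + m), 0; rewrite scale0r addr0 scalerDl; split=> // -[].
by move/(add_eq0 stR).
Qed.

(** Combinations of [x] and [s *: x + t *: y] are combinations of [x] and [y]; the new coefficients
    do not both vanish, since [R] has neither zero divisors nor cancelling sums. *)
Lemma interval_le_right (x y : V) (Z : set V) : x <> 0 -> y <> 0 ->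
  interval (ray x) (ray y) Z -> interval_le (ray x) Z (ray y).
Proof.
move=> x0 y0; rewrite (interval_ray stR sfR x0 y0) => -[s [t [st ->]]].
have z0 := lincomb2_nonzero x0 y0 st.
rewrite /interval_le !(interval_ray stR sfR) // => T [l [m [lm ->]]].
exists (l + m * s), (m * t); rewrite scalerDr scalerDl !scalerA addrA.
split=> // -[/(add_eq0 stR)[l0 ms0] mt0].
have m0 : m <> 0 by move=> m0; apply: lm.
apply: st; split; apply: contrapT => n0.
  exact: (mul_nonzero stR sfR m0 n0 ms0).
exact: (mul_nonzero stR sfR m0 n0 mt0).
Qed.

(** For the order of the interval, [ray x] is least and [ray y] greatest: an increasing [f] would
    put [f (ray x)] below [f Z], a decreasing one [f (ray y)]. *)
Lemma not_monotone_interior_min (f : set V -> R) (x y : V) (Z : set V) :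
  x <> 0 -> y <> 0 -> interval (ray x) (ray y) Z ->
  ~ ghost_le (f (ray x)) (f Z) -> ~ ghost_le (f (ray y)) (f Z) ->
  ~ monotone_on_interval f (ray x) (ray y).
Proof.
move=> x0 y0 xyZ nx ny [mono|mono].
  apply: nx; apply: mono => //; first exact: interval_left.
  have := xyZ; rewrite (interval_ray stR sfR x0 y0) => -[s [t [st ->]]].
  exact/interval_le_left/lincomb2_nonzero.
apply: ny; apply: mono => //; first exact: interval_right.
exact: interval_le_right.
Qed.

(** * The convex hull and the minimum on it *)

Lemma conv_sub_sums (I : finType) (y : I -> V) : (forall i, y i <> 0) ->
  conv (range (fun i => ray (y i))) `<=`
  [set Z | exists2 l : I -> R, (exists i, l i <> 0) & Z = ray (\sum_i l i *: y i)].
Proof.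
move=> y0; have sum0 (l : I -> R) i : l i <> 0 -> \sum_i l i *: y i <> 0.
  by move=> li; apply: (@sumv_nonzero _ i) => /scale_eq0; auto.
(* It suffices that the rays of nontrivial combinations form a convex set containing the
   generators. *)
apply: smallest_sub.
  split=> [Z [l [i li] ->]|X Y [l [i li] ->] [m [j mj] ->]].
    by exists (\sum_i l i *: y i) => //; apply: sum0 li.
  rewrite interval_ray //; [|exact: sum0 li|exact: sum0 mj].
  move=> Z [s [t [st ->]]]; exists (fun k => s * l k + t * m k); last first.
    congr (ray _); rewrite !scaler_sumr -big_split; apply: eq_bigr => k _.
    by rewrite scalerDl !scalerA.
  have [s0|s0] := pselect (s = 0).
    exists j => /(add_eq0 stR)[_]; apply: (mul_nonzero stR sfR) => // t0.
    exact: st.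
  by exists i => /(add_eq0 stR)[+ _]; apply: (mul_nonzero stR sfR).
move=> Z [i _ <-]; exists (fun j => (j == i)%:R).
  by exists i; rewrite eqxx; apply: (one_nonzero sfR).
rewrite (bigD1 i) //= eqxx scale1r big1 ?addr0 // => j /negPf ->.
by rewrite scale0r.
Qed.

Lemma conv_interval (S : set (set V)) X Y : S X -> S Y ->
  interval X Y `<=` conv S.
Proof.
move=> SX SY Z XYZ A [[_ cA] SA].
exact: (cA X Y (SA _ SX) (SA _ SY)).
Qed.

Lemma CS_conv_min (n : nat) (n_gt0 : (0 < n)%N) (w : V) (y : 'I_n -> V) :
  w <> 0 -> (forall i, y i <> 0) ->
  let Y i := ray (y i) in let C := conv (range Y) in
  exists Z : set V, [/\ C Z,
    forall Z', C Z' -> ghost_le (CS q b (ray w) Z) (CS q b (ray w) Z') &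
    (exists r, Z = Y r) \/
    exists r s, has_median b (ray w) (Y r) (Y s) /\
      Z = median b (ray w) (Y r) (Y s)].
Proof.
move=> w0 y0 Y C.
(* Where the median is undefined, a vertex replaces it, so the candidates form a finite family of
   nonzero vectors. *)
pose bad r s := `[< b w (y r) = 0 /\ b w (y s) = 0 >].
pose cand (c : 'I_n + 'I_n * 'I_n) : V := match c with
  | inl r => y r
  | inr (r, s) => if bad r s then y r else median_vec w (y r) (y s) end.
have cand0 c : cand c <> 0.
  case: c => [r|[r s]] //=; rewrite /bad; case: asboolP => // nb.
  by apply: lincomb2_nonzero => // -[? ?]; apply: nb.
have [c min_c] := ghost_argmin stR (inl (Ordinal n_gt0))
  (fun c => CS q b (ray w) (ray (cand c))).
have cs_min d : cs_le w (cand c) (cand d).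
  apply/CS_leP => //; have := min_c d.
  by rewrite (CS_mul w0 (cand0 c)).1 (CS_mul w0 (cand0 d)).1.
have YS r : range Y (Y r) by exists r.
have YC r : C (Y r) by move=> A [_ SA]; apply: SA.
have med r s : ~ (b w (y r) = 0 /\ b w (y s) = 0) ->
    has_median b (ray w) (Y r) (Y s) /\
    ray (median_vec w (y r) (y s)) = median b (ray w) (Y r) (Y s).
  move=> nb; split; first exact/(has_median_ray stR sfR qb).
  by rewrite (median_ray stR sfR qb).
exists (ray (cand c)); split.
- case: (c) => [r|[r s]] /=; first exact: YC.
  rewrite /bad; case: asboolP => [_|/med[hm ->]]; first exact: YC.
  exact: (conv_interval (YS r) (YS s) (median_interval w0 (y0 r) (y0 s) hm)).
- move=> Z' /(conv_sub_sums y0)[l [i li] ->].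
  apply/CS_leP => //.
    by apply: (@sumv_nonzero _ i) => /scale_eq0; auto.
  apply: cs_le_sum => // [r|r s nb]; first exact: (cs_min (inl r)).
  by have := cs_min (inr (r, s)); rewrite /= /bad asboolF.
- case: (c) => [r|[r s]] /=; first by left; exists r.
  rewrite /bad; case: asboolP => [_|/med hm]; first by left; exists r.
  by right; exists r, s.
Qed.

End QuadraticPair.

Theorem theorem8p1 (R : comPzSemiRingType) (V : lSemiModType R)
    (q : V -> R) (b : V -> V -> R)
    (stR : supertropical R) (sfR : ghost_semifield R)
    (qb : quadratic_pair q b) (an : anisotropic q)
    (n : nat) (n_gt0 : (0 < n)%N)
    (W : set V) (Y : 'I_n -> set V)
    (rayW : Ray V W) (rayY : forall i : 'I_n, Ray V (Y i)) :
  let C := conv (range Y) in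
  exists Z : set V,
    C Z /\
    (forall Z' : set V, C Z' -> ghost_le (CS q b W Z) (CS q b W Z')) /\
    ((exists r : 'I_n, Z = Y r) \/
     (exists r s : 'I_n,
        (r <= s)%N /\
        ~ monotone_on_interval (CS q b W) (Y r) (Y s) /\
        has_median b W (Y r) (Y s) /\
        Z = median b W (Y r) (Y s))).
Proof.
case: rayW => w w0 ->.
have [y y0 /funext YE] : exists2 y : 'I_n -> V,
    forall i, y i <> 0 & forall i, Y i = ray (y i).
  have [y yP] := choice (fun i => let: ex_intro2 x x0 E := rayY i in
    ex_intro (fun x => x <> 0 /\ Y i = ray x) x (conj x0 E)).
  by exists y => i; case: (yP i).
move: Y YE {rayY} => _ -> C.
have [Z [CZ minZ ZP]] := CS_conv_min stR sfR qb an n_gt0 w0 y0.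
have YC r : C (ray (y r)) by move=> A [_]; apply; exists r.
(* A vertex attaining the minimum is preferred. Otherwise no vertex value is below that of [Z], so
   [Z] is a median and monotonicity on its interval fails. *)
have [[r Zr]|no_vertex] := pselect (exists r,
    ghost_le (CS q b (ray w) (ray (y r))) (CS q b (ray w) Z)).
  exists (ray (y r)); split=> //; split; last by left; exists r.
  move=> Z' CZ'; have := minZ _ CZ'.
  by move: Zr; rewrite /ghost_le => rZ ZZ'; rewrite -ZZ' addrA rZ.
exists Z; do 2?split=> //; case: ZP => [|[r [s [hm ZE]]]]; first by left.
have nm i j : has_median b (ray w) (ray (y i)) (ray (y j)) ->
    Z = median b (ray w) (ray (y i)) (ray (y j)) ->
    ~ monotone_on_interval (CS q b (ray w)) (ray (y i)) (ray (y j)).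
  move=> hij Zij; apply: (not_monotone_interior_min stR sfR qb an (Z := Z)) => //.
  - by rewrite Zij; apply: (median_interval stR sfR qb).
  - by move=> H; apply: no_vertex; exists i.
  - by move=> H; apply: no_vertex; exists j.
(* The median is symmetric, so the indices can be swapped to obtain the required order. *)
right; case/orP: (leq_total r s) => rs.
  by exists r, s; do 3?split=> //; apply: nm.
have hm' : has_median b (ray w) (ray (y s)) (ray (y r)).
  by move=> [? ?]; apply: hm.
have ZE' : Z = median b (ray w) (ray (y s)) (ray (y r)).
  by rewrite ZE (medianC stR sfR qb).
by exists s, r; do 3?split=> //; apply: nm.
Qed.
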